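(* Let $a>0$ and let $\mathrm{Exp}_a:\mathbb{C}\to\mathbb{C}\times\mathbb{R}$, $\mathrm{Exp}_a(u+iv)=(\exp_{\mathbb{C}}(u+iv),\,av)$ for $u,v\in\mathbb{R}$. Then there is a diffeomorphism $$\Xi:\ \mathrm{Exp}_a(\mathbb{C})\ \xrightarrow{\ \cong\ }\ \Sigma_{log}^{C^\infty}.$$ Thus the (exponential) helicoid $\mathrm{Exp}_a(\mathbb{C})\subset\mathbb{R}^3$ is $C^\infty$-diffeomorphic to the Riemann surface of the logarithm $\Sigma_{log}$, when the latter is equipped with the induced smooth sub-atlas $\mathcal{A}^{C^\infty}_{\Sigma_{log}}$ of the holomorphic atlas $\mathcal{A}^{\mathcal{O}}_{\Sigma_{log}}$ coming from $\mathbb{R}^4$.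
   Context: $\exp_{\mathbb{C}}(z)=e^z$ is the complex exponential. Diffeomorphism means $C^\infty$-diffeomorphism. The helicoid $\mathrm{Exp}_a(\mathbb{C})=\{(e^u\cos v,e^u\sin v,av): u,v\in\mathbb{R}\}$ is regarded as a smooth submanifold of $\mathbb{C}\times\mathbb{R}\cong\mathbb{R}^3$ with the induced structure. The Riemann surface of the logarithm $\Sigma_{log}$ is the graph of $w=e^z$ in $\mathbb{C}^2\cong\mathbb{R}^4$, given parametrically by $\mathbb{C}\ni z\mapsto(z,\exp_{\mathbb{C}}(z))\in\mathbb{C}^2$, i.e. $\Sigma_{log}=\{(u,v,e^u\cos v,e^u\sin v):u,v\in\mathbb{R}\}$. $\mathcal{A}^{\mathcal{O}}_{\Sigma_{log}}$ is its holomorphic atlas induced from $\mathbb{C}^2\cong\mathbb{R}^4$, and $\Sigma_{log}^{C^\infty}=(\Sigma_{log},\mathcal{A}^{C^\infty}_{\Sigma_{log}})$ denotes $\Sigma_{log}$ with the induced smooth atlas coming from $\mathbb{R}^4$. *)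

(* Defs.v *)
From mathcomp Require Import all_boot all_order all_algebra.
From mathcomp Require Import all_classical all_reals all_analysis.
From mathcomp.real_closed Require Export complex.
Set Implicit Arguments.
Unset Strict Implicit.
Unset Printing Implicit Defensive.
Import Order.TTheory GRing.Theory Num.Theory.
Import numFieldNormedType.Exports.
Local Open Scope classical_set_scope.
Local Open Scope ring_scope.
Local Open Scope complex_scope.

Section Smoothness.
Variable R : realType.

(* f is of class C^k on U; only meaningful for U open.  In finite dimension
   the differential x |-> 'd f x is C^k iff all x |-> 'd f x v = 'D_v f x are. *)
Fixpoint class_C (k m n : nat) (U : set 'rV[R]_m) (f : 'rV[R]_m -> 'rV[R]_n)
    : Prop :=
  match k with
  | 0%N => forall x, U x -> {for x, continuous f}
  | k'.+1 => (forall x, U x -> differentiable f x) /\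
             (forall v : 'rV[R]_m,
                class_C k' U (fun x => 'D_v f x : 'rV[R]_n))
  end.

Definition smooth (m n : nat) (U : set 'rV[R]_m) (f : 'rV[R]_m -> 'rV[R]_n)
    : Prop :=
  forall k, class_C k U f.

(* Jm and Jn are the multiplications by the imaginary unit on R^m and R^n:
   holomorphic = C^oo with complex-linear differential (Cauchy-Riemann). *)
Definition holomorphic (m n : nat) (Jm : 'rV[R]_m -> 'rV[R]_m)
    (Jn : 'rV[R]_n -> 'rV[R]_n) (U : set 'rV[R]_m)
    (f : 'rV[R]_m -> 'rV[R]_n) : Prop :=
  smooth U f /\
  forall x v, U x -> 'D_(Jm v) f x = Jn ('D_v f x).

End Smoothness.

Section Manifolds.
Variable R : realType.

(* A chart cmap : cdom -> R^d together with its inverse cinv; the values of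
   cmap outside cdom and of cinv outside cmap @` cdom are irrelevant. *)
Record chart (T : Type) (d : nat) := Chart {
  cdom : set T;
  cmap : T -> 'rV[R]_d;
  cinv : 'rV[R]_d -> T }.

Definition cim (T : Type) (d : nat) (c : chart T d) : set 'rV[R]_d :=
  cmap c @` cdom c.

(* c is a homeomorphism from a relatively open subset of M (with the subspace
   topology) onto an open subset of R^d. *)
Definition is_chart (T : topologicalType) (d : nat) (M : set T)
    (c : chart T d) : Prop :=
  [/\ exists2 W : set T, open W & cdom c = M `&` W,
      open (cim c),
      (forall p, cdom c p -> cinv c (cmap c p) = p),
      {within cdom c, continuous (cmap c)} &
      {within cim c, continuous (cinv c)}].

(* reg U f is the regularity required of the transition maps f on U. *)
Definition is_atlas (T : topologicalType) (d : nat)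
    (reg : set 'rV[R]_d -> ('rV[R]_d -> 'rV[R]_d) -> Prop)
    (M : set T) (A : set (chart T d)) : Prop :=
  [/\ (forall c, A c -> is_chart M c),
      (forall p, M p -> exists2 c, A c & cdom c p) &
      (forall c c', A c -> A c' ->
         reg (cmap c @` (cdom c `&` cdom c')) (cmap c' \o cinv c))].

Definition smooth_atlas (T : topologicalType) (d : nat) (M : set T)
    (A : set (chart T d)) : Prop :=
  is_atlas (@smooth R d d) M A.

Definition smooth_map (S T : topologicalType) (d e : nat)
    (M : set S) (A : set (chart S d)) (N : set T) (B : set (chart T e))
    (f : S -> T) : Prop :=
  (forall p, M p -> N (f p)) /\
  forall p, M p -> exists (c : chart S d) (c' : chart T e),
    [/\ A c /\ B c', cdom c p, f @` cdom c `<=` cdom c' &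
        smooth (cim c) (cmap c' \o f \o cinv c)].

(* f : S -> T is only relevant on M, g : T -> S only on N. *)
Definition diffeomorphism (S T : topologicalType) (d e : nat)
    (M : set S) (A : set (chart S d)) (N : set T) (B : set (chart T e))
    (f : S -> T) : Prop :=
  smooth_map M A N B f /\
  exists g : T -> S,
    [/\ smooth_map N B M A g, (forall p, M p -> g (f p) = p) &
        (forall q, N q -> f (g q) = q)].

(* c is the chart of S cut out by Phi on W: Phi is a bijection from the open
   set W onto an open set, with inverse Psi, it maps S to R^d x {0}, and c is
   the resulting coordinate map from S `&` W to R^d. *)
Definition slice_chart (d k : nat) (S W : set 'rV[R]_(d + k))
    (Phi Psi : 'rV[R]_(d + k) -> 'rV[R]_(d + k))
    (c : chart 'rV[R]_(d + k) d) : Prop :=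
  [/\ open W /\ open (Phi @` W),
      (forall x, W x -> Psi (Phi x) = x),
      Phi @` (S `&` W) = Phi @` W `&` [set y | rsubmx y = 0],
      cdom c = S `&` W &
      (forall x, cdom c x -> cmap c x = lsubmx (Phi x)) /\
      (forall y, cim c y -> cinv c y = Psi (row_mx y 0))].

(* The smooth structure that S inherits as a d-dimensional embedded
   submanifold of R^(d + k): all smooth slice charts. *)
Definition induced_smooth_atlas (d k : nat) (S : set 'rV[R]_(d + k))
    : set (chart 'rV[R]_(d + k) d) :=
  [set c | exists (W : set 'rV[R]_(d + k))
             (Phi Psi : 'rV[R]_(d + k) -> 'rV[R]_(d + k)),
     [/\ smooth W Phi, smooth (Phi @` W) Psi & slice_chart S W Phi Psi c]].

End Manifolds.

Section HelicoidAndLogarithm.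
Variable R : realType.

Definition expC (z : R[i]) : R[i] :=
  let: u +i* v := z in (expR u * cos v) +i* (expR u * sin v).

Definition Exp (a : R) (z : R[i]) : R[i] * R := (expC z, a * complex.Im z).

Definition CtoR2 (z : R[i]) : 'rV[R]_2 :=
  \row_(j < 2) [:: complex.Re z; complex.Im z]`_j.

Definition CRtoR3 (p : R[i] * R) : 'rV[R]_(2 + 1) :=
  \row_(j < 2 + 1) [:: complex.Re p.1; complex.Im p.1; p.2]`_j.

Definition C2toR4 (p : R[i] * R[i]) : 'rV[R]_(2 + 2) :=
  \row_(j < 2 + 2)
    [:: complex.Re p.1; complex.Im p.1; complex.Re p.2; complex.Im p.2]`_j.

Definition R2toC (x : 'rV[R]_2) : R[i] :=
  x 0 (@Ordinal 2 0 isT) +i* x 0 (@Ordinal 2 1 isT).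

Definition R4toC2 (x : 'rV[R]_(2 + 2)) : R[i] * R[i] :=
  (x 0 (@Ordinal 4 0 isT) +i* x 0 (@Ordinal 4 1 isT),
   x 0 (@Ordinal 4 2 isT) +i* x 0 (@Ordinal 4 3 isT)).

Definition J2 (x : 'rV[R]_2) : 'rV[R]_2 := CtoR2 ('i * R2toC x).

Definition J4 (x : 'rV[R]_(2 + 2)) : 'rV[R]_(2 + 2) :=
  let p := R4toC2 x in C2toR4 ('i * p.1, 'i * p.2).

Definition helicoid (a : R) : set 'rV[R]_(2 + 1) :=
  CRtoR3 @` range (Exp a).

Definition Sigma_log : set 'rV[R]_(2 + 2) :=
  C2toR4 @` range (fun z : R[i] => (z, expC z)).

(* Charts in C are read in R^2, with complex structure J2. *)
Definition holomorphic_atlas (T : topologicalType) (M : set T)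
    (A : set (chart R T 2)) : Prop :=
  is_atlas (holomorphic J2 J2) M A.

(* The holomorphic structure that S inherits as a one-dimensional complex
   submanifold of C^2 = R^4: all slice charts given by a biholomorphic map. *)
Definition induced_holomorphic_atlas (S : set 'rV[R]_(2 + 2))
    : set (chart R 'rV[R]_(2 + 2) 2) :=
  [set c | exists (W : set 'rV[R]_(2 + 2))
             (Phi Psi : 'rV[R]_(2 + 2) -> 'rV[R]_(2 + 2)),
     [/\ holomorphic J4 J4 W Phi, holomorphic J4 J4 (Phi @` W) Psi &
         slice_chart S W Phi Psi c]].

End HelicoidAndLogarithm.

Arguments Sigma_log R : clear implicits.

(* Main.v *)
From HB Require Import structures.
Require Import Defs.
From mathcomp Require Import all_boot all_order all_algebra.
From mathcomp Require Import all_classical all_reals all_analysis.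
From mathcomp Require Import ring.
Set Implicit Arguments.
Unset Strict Implicit.
Unset Printing Implicit Defensive.
Import Order.TTheory GRing.Theory Num.Theory.
Import numFieldNormedType.Exports.
Local Open Scope classical_set_scope.
Local Open Scope ring_scope.

(* Both surfaces have a global slice chart with image R^2 and coordinates (u, v).
   For the graph of exp it comes from the biholomorphic shear
   (z, w) |-> (z, w - e^z) of C^2.  For the helicoid, rotate the horizontal
   plane at height t by the angle - t / a: the helicoid becomes the half-plane
   where the first coordinate r is positive and the second one vanishes, so
   (ln r, t / a, second coordinate) straightens it.  The diffeomorphism is the
   identity of R^2 read in these two charts.  Transition maps of arbitrary slice
   charts are composites y |-> lsubmx (Phi' (Psi (y, 0))), hence smooth, and
   holomorphic when Phi' and Psi are. *)

(** * Differentials: locality, coordinates, composition with a real function *)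

Section Differentials.
Context {R : realType}.
Implicit Types V W : normedModType R.

(** The first-order expansion of [f] at [x] is also one of [g], because the two maps agree at [x]
    and near it; uniqueness of the differential then identifies ['d g x] with ['d f x]. *)
Lemma near_eq_is_diff V W (f g df : V -> W) (x : V) :
  (\near x, f x = g x) -> is_diff x f df -> is_diff x g df.
Proof.
move=> fg dfx; have fx : differentiable f x by [].
have E : g \o shift x = cst (g x) + 'd f x +o_ 0 id.
  apply/eqaddoP => e e0.
  have /eqaddoP/(_ e e0) := diff_locally fx.
  have : \forall h \near 0, f (h + x) = g (h + x).
    by move: fg; rewrite (near_shift 0 x); apply: filterS => h /=; rewrite subr0.
  rewrite !near_simpl; apply: filter_app2; near=> h => fgh.
  by rewrite !fctE /= fgh (nbhs_singleton fg).
have dg := diff_unique (diff_continuous fx) E.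
have := @diff_val _ _ _ _ _ _ _ dfx; rewrite -dg => dgE.
by split => //; apply/diff_locallyP; rewrite dg; split => //; exact: diff_continuous.
Unshelve. all: by end_near. Qed.

Lemma is_diff_derive V W (f df : V -> W) (x v : V) :
  is_diff x f df -> 'D_v f x = df v.
Proof. by move=> dfx; rewrite deriveE// diff_val. Qed.

Lemma is_diff_coord V m n (f df : V -> 'M[R]_(m, n)) (x : V) i j :
  is_diff x f df -> is_diff x (fun y => f y i j : R) (fun v => df v i j).
Proof.
move=> dfx; have fx : differentiable f x by [].
have dc := differentiable_coord (f x) i j.
split; first exact: (differentiable_comp fx dc).
apply/funext => v.
rewrite -deriveE; last exact: (differentiable_comp fx dc).
rewrite -(is_diff_derive v dfx) derive_mx ?mxE//; exact: diff_derivable.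
Qed.

(** Differentiability comes from writing [f] as the sum of its coordinates times the basis vectors;
    the differential is then read off coordinate by coordinate from directional derivatives. *)
Lemma is_diff_rV V n (f df : V -> 'rV[R]_n) (x : V) :
  (forall j, is_diff x (fun y => f y 0 j : R) (fun v => df v 0 j)) ->
  is_diff x f df.
Proof.
move=> dfx.
have fx : differentiable f x.
  rewrite (_ : f = \sum_j (fun y => f y 0 j *: delta_mx 0 j)); last first.
    by apply/funext => y; rewrite fct_sumE [LHS]row_sum_delta.
  apply: differentiable_sum => j; apply: differentiableZl.
  exact: (@ex_diff _ _ _ _ _ _ _ (dfx j)).
split=> //; apply/funext => v; apply/rowP => j.
rewrite -deriveE// derive_mx ?mxE; last exact: diff_derivable.
exact: is_diff_derive.
Qed.

Lemma is_diff_linear V W (f : {linear V -> W}) (x : V) :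
  continuous f -> is_diff x f f.
Proof. by move=> fc; split; [exact: linear_differentiable|exact: diff_lin]. Qed.

(** Chain rule in the form that turns one-variable derivatives, such as those of exp, cos, sin and
    ln, into differentials on [V]. *)
Lemma is_diff_real_comp V (g : R -> R) (f df : V -> R) (x : V) (l : R) :
  is_derive (f x) 1 g l -> is_diff x f df ->
  is_diff x (g \o f) (fun v => l * df v).
Proof.
move=> dg dfx; have gx : differentiable g (f x) by apply/derivable1_diffP.
apply: is_diff_eq; first exact: is_diff_comp dfx (differentiableP gx).
apply/funext => v /=; rewrite diff1E// derive1E (@derive_val _ _ _ _ _ _ _ dg).
by rewrite mulrC.
Qed.

End Differentials.

(** * Calculus of maps of class C^k *)

Section Ck.
Context {R : realType}.
Implicit Types V W : normedModType R.

(* [class_C] with an arbitrary normed codomain, so that it applies to the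
   real-valued coordinates, for which a product is available. *)
Fixpoint Ck (k : nat) V W (U : set V) (f : V -> W) : Prop :=
  match k with
  | 0%N => forall x, U x -> {for x, continuous f}
  | k'.+1 => (forall x, U x -> differentiable f x) /\
             forall v, Ck k' U (fun x => 'D_v f x)
  end.

Lemma class_CE k m n (U : set 'rV[R]_m) (f : 'rV[R]_m -> 'rV[R]_n) :
  class_C k U f <-> Ck k U f.
Proof.
elim: k f => [//|k IH] f /=.
by split=> -[df Df]; split=> // v; apply/IH.
Qed.

(** On an open set, equality on [U] is equality near each point of [U], so it is inherited by the
    directional derivatives and induction on [k] applies. *)
Lemma Ck_near V W k (U : set V) (f g : V -> W) : open U ->
  (forall x, U x -> f x = g x) -> Ck k U f -> Ck k U g.
Proof.
move=> oU; have near_fg : forall f g : V -> W, (forall x, U x -> f x = g x) ->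
    forall x, U x -> \near x, f x = g x.
  move=> {}f {}g fg x Ux; have : nbhs x U by apply: open_nbhs_nbhs.
  exact: filterS.
elim: k f g => [|k IH] f g fg /=.
  move=> fc x Ux; have := fc x Ux.
  rewrite /prop_for /continuous_at -(fg x Ux); apply: cvg_trans.
  apply: near_eq_cvg; exact: near_fg.
move=> [df Df]; split=> [x Ux|v].
  have /differentiableP dfx := df _ Ux.
  by have [] := near_eq_is_diff (near_fg _ _ fg x Ux) dfx.
apply: IH (Df v) => x Ux; exact/near_eq_derive/near_fg.
Qed.

Lemma Ck_subset V W k (U U' : set V) (f : V -> W) :
  U' `<=` U -> Ck k U f -> Ck k U' f.
Proof.
move=> UU'; elim: k f => [|k IH] f /=; first by move=> fc x /UU'; exact: fc.
by move=> [df Df]; split=> [x /UU'|v]; [exact: df|exact: IH].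
Qed.

(** The introduction rule behind the closure properties below: once a differentiation rule gives an
    explicit differential, only its dependence on the base point, for each fixed direction, has to
    be shown of class C^k. *)
Lemma Ck_is_diff V W k (U : set V) (f : V -> W) (df : V -> V -> W) : open U ->
  (forall x, U x -> is_diff x f (df x)) ->
  (forall v, Ck k U (fun x => df x v)) -> Ck k.+1 U f.
Proof.
move=> oU dfP dfC; split=> [x Ux|v].
  exact: (@ex_diff _ _ _ _ _ _ _ (dfP x Ux)).
apply: Ck_near (dfC v) => // x Ux; apply/esym/is_diff_derive; exact: dfP.
Qed.

Lemma Ck_diff V W k (U : set V) (f : V -> W) : Ck k.+1 U f ->
  forall x, U x -> is_diff x f (fun v => 'D_v f x).
Proof.
move=> [df _] x Ux; have dfx := df _ Ux.
by split=> //; apply/funext => v; rewrite deriveE.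
Qed.

Lemma Ck_derive V W k (U : set V) (f : V -> W) v :
  Ck k.+1 U f -> Ck k U (fun x => 'D_v f x).
Proof. by move=> [_ Df]; exact: Df. Qed.

Lemma CkW V W k (U : set V) (f : V -> W) : Ck k.+1 U f -> Ck k U f.
Proof.
elim: k f => [|k IH] f [df Df].
  by move=> x Ux; apply: differentiable_continuous; exact: df.
by split=> // v; apply: IH.
Qed.

Lemma Ck_cst V W k (U : set V) (c : W) : open U -> Ck k U (fun=> c).
Proof.
move=> oU; elim: k c => [|k IH] c; first by move=> x _; exact: cvg_cst.
by apply: (@Ck_is_diff _ _ _ _ _ (fun x v => 0)).
Qed.

(** The differential of a linear map does not depend on the point, so one differentiation reduces
    the claim to constants. *)
Lemma Ck_linear V W k (U : set V) (f : {linear V -> W}) : open U ->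
  continuous f -> Ck k U f.
Proof.
move=> oU fc; case: k => [|k]; first by move=> x _; exact: fc.
apply: (@Ck_is_diff _ _ _ _ _ (fun=> f)) => // [x _|v]; first exact: is_diff_linear.
exact: Ck_cst.
Qed.

Lemma CkD V W k (U : set V) (f g : V -> W) : open U ->
  Ck k U f -> Ck k U g -> Ck k U (fun x => f x + g x).
Proof.
move=> oU; elim: k f g => [|k IH] f g Cf Cg.
  by move=> x Ux; apply: cvgD; [exact: Cf|exact: Cg].
apply: (@Ck_is_diff _ _ _ _ _ (fun x v => 'D_v f x + 'D_v g x)) => // [x Ux|v].
  exact: is_diffD (Ck_diff Cf Ux) (Ck_diff Cg Ux).
by apply: IH; [exact: Ck_derive Cf|exact: Ck_derive Cg].
Qed.

Lemma CkM V k (U : set V) (f g : V -> R) : open U ->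
  Ck k U f -> Ck k U g -> Ck k U (fun x => f x * g x).
Proof.
move=> oU; elim: k f g => [|k IH] f g Cf Cg.
  by move=> x Ux; apply: cvgM; [exact: Cf|exact: Cg].
apply: (@Ck_is_diff _ _ _ _ _ (fun x v => f x * 'D_v g x + g x * 'D_v f x))
    => // [x Ux|v].
  exact: is_diffM (Ck_diff Cf Ux) (Ck_diff Cg Ux).
apply: CkD => //; apply: IH; by [exact: CkW|exact: Ck_derive Cf|exact: Ck_derive Cg].
Qed.

Lemma CkN V k (U : set V) (f : V -> R) : open U ->
  Ck k U f -> Ck k U (fun x => - f x).
Proof.
move=> oU Cf; apply: (@Ck_near _ _ _ _ (fun x => - 1 * f x)) => // [x _|].
  by rewrite mulN1r.
by apply: CkM => //; exact: Ck_cst.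
Qed.

Lemma CkB V k (U : set V) (f g : V -> R) : open U ->
  Ck k U f -> Ck k U g -> Ck k U (fun x => f x - g x).
Proof. by move=> oU Cf Cg; apply: CkD => //; exact: CkN. Qed.

Lemma Ck_sum V W k n (U : set V) (f : 'I_n -> V -> W) : open U ->
  (forall i, Ck k U (f i)) -> Ck k U (fun x => \sum_i f i x).
Proof.
move=> oU Cf; apply: (@Ck_near _ _ _ _ (\sum_i f i)) => // [x _|].
  by rewrite fct_sumE.
elim/big_rec: _ => [|i g _ Cg]; first exact: Ck_cst.
exact: CkD.
Qed.

Lemma Ck_coord V k n (U : set V) (f : V -> 'rV[R]_n) j : open U ->
  Ck k U f -> Ck k U (fun x => f x 0 j).
Proof.
move=> oU; elim: k f => [|k IH] f Cf.
  move=> x Ux.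
  have := @continuous_comp _ _ _ f (fun y : 'rV[R]_n => y 0 j : R) x
    (Cf x Ux) (@coord_continuous _ _ _ _ _ _).
  exact.
apply: (@Ck_is_diff _ _ _ _ _ (fun x v => 'D_v f x 0 j)) => // [x Ux|v].
  exact: (@is_diff_coord _ _ _ _ _ _ _ 0 j (Ck_diff Cf Ux)).
by apply: IH; exact: Ck_derive Cf.
Qed.

Lemma CkZl V W k (U : set V) (f : V -> R) (w : W) : open U ->
  Ck k U f -> Ck k U (fun x => f x *: w).
Proof.
move=> oU; elim: k f => [|k IH] f Cf.
  by move=> x Ux; apply: cvgZr_tmp; exact: Cf.
apply: (@Ck_is_diff _ _ _ _ _ (fun x v => 'D_v f x *: w)) => // [x Ux|v].
  have [dfx dfE] := Ck_diff Cf Ux.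
  split; first exact: differentiableZl.
  by rewrite diffZl// dfE.
by apply: IH; exact: Ck_derive Cf.
Qed.

Lemma Ck_rV V k n (U : set V) (f : V -> 'rV[R]_n) : open U ->
  (forall j, Ck k U (fun x => f x 0 j)) -> Ck k U f.
Proof.
move=> oU Cf.
apply: (@Ck_near _ _ _ _ (fun x => \sum_j f x 0 j *: delta_mx 0 j)) => // [x _|].
  by rewrite [RHS]row_sum_delta.
by apply: Ck_sum => // j; exact: CkZl.
Qed.

(** By the chain rule the derivative of [g \o f] is a sum of products of coordinates of ['D_v f]
    with partial derivatives of [g] composed with [f]; the induction hypothesis applies to the
    latter. A real codomain makes [CkM] available. *)
Lemma Ck_comp_scalar V k m (U : set V) (U' : set 'rV[R]_m) (f : V -> 'rV[R]_m)
    (g : 'rV[R]_m -> R) : open U -> (forall x, U x -> U' (f x)) ->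
  Ck k U f -> Ck k U' g -> Ck k U (g \o f).
Proof.
move=> oU UU'; elim: k f g UU' => [|k IH] f g UU' Cf Cg.
  by move=> x Ux; apply: continuous_comp; [exact: Cf|exact/Cg/UU'].
apply: (@Ck_is_diff _ _ _ _ _ (fun x v =>
    \sum_j 'D_v f x 0 j * 'D_(delta_mx 0 j) g (f x))) => // [x Ux|v].
  have df := Ck_diff Cf Ux; have dg := Ck_diff Cg (UU' _ Ux).
  have H := is_diff_comp df dg. apply: (is_diff_eq H).
  apply/funext => v /=.
  have dgx : differentiable g (f x) by [].
  rewrite deriveE// [in LHS](row_sum_delta ('D_v f x)) linear_sum/=.
  by apply: eq_bigr => j _; rewrite linearZ (deriveE _ dgx).
apply: Ck_sum => // j; apply: CkM => //.
  exact: (@Ck_coord _ _ _ _ (fun x => derive f x v) j oU (Ck_derive v Cf)).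
by apply: (IH f (fun y => 'D_(delta_mx 0 j) g y)) => //; [exact: CkW|exact: Ck_derive Cg].
Qed.

Lemma Ck_comp V k m n (U : set V) (U' : set 'rV[R]_m) (f : V -> 'rV[R]_m)
    (g : 'rV[R]_m -> 'rV[R]_n) : open U -> open U' ->
  (forall x, U x -> U' (f x)) ->
  Ck k U f -> Ck k U' g -> Ck k U (g \o f).
Proof.
move=> oU oU' UU' Cf Cg; apply: Ck_rV => // j.
exact: (@Ck_comp_scalar _ _ _ U U' f (fun y => g y 0 j) oU UU' Cf (Ck_coord j oU' Cg)).
Qed.

Lemma Ck_expR V k (U : set V) (f : V -> R) : open U ->
  Ck k U f -> Ck k U (fun x => expR (f x)).
Proof.
move=> oU; elim: k f => [|k IH] f Cf.
  by move=> x Ux; apply: continuous_comp; [exact: Cf|exact: continuous_expR].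
apply: (@Ck_is_diff _ _ _ _ _ (fun x v => expR (f x) * 'D_v f x)) => // [x Ux|v].
  exact: (is_diff_real_comp (is_derive_expR _) (Ck_diff Cf Ux)).
apply: CkM => //; last by exact: Ck_derive Cf.
by apply: IH; exact: CkW.
Qed.

(** Cosine and sine go through the induction together, since the derivative of each contains the
    other. *)
Lemma Ck_cos_sin V k (U : set V) (f : V -> R) : open U ->
  Ck k U f -> Ck k U (fun x => cos (f x)) /\ Ck k U (fun x => sin (f x)).
Proof.
move=> oU; elim: k f => [|k IH] f Cf.
  by split=> x Ux; apply: continuous_comp;
    by [exact: Cf|exact: continuous_cos|exact: continuous_sin].
have [Cc Cs] := IH _ (CkW Cf).
split.
  apply: (@Ck_is_diff _ _ _ _ _ (fun x v => - sin (f x) * 'D_v f x)) => // [x Ux|v].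
    exact: (is_diff_real_comp (is_derive_cos _) (Ck_diff Cf Ux)).
  by apply: CkM => //; [exact: CkN|exact: Ck_derive Cf].
apply: (@Ck_is_diff _ _ _ _ _ (fun x v => cos (f x) * 'D_v f x)) => // [x Ux|v].
  exact: (is_diff_real_comp (is_derive_sin _) (Ck_diff Cf Ux)).
by apply: CkM => //; exact: Ck_derive Cf.
Qed.

Lemma CkV V k (U : set V) (f : V -> R) : open U -> (forall x, U x -> f x != 0) ->
  Ck k U f -> Ck k U (fun x => (f x)^-1).
Proof.
move=> oU f0; elim: k f f0 => [|k IH] f f0 Cf.
  by move=> x Ux; apply: cvgV; [exact: f0|exact: Cf].
apply: (@Ck_is_diff _ _ _ _ _ (fun x v => - ((f x)^-1 * (f x)^-1) * 'D_v f x))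
    => // [x Ux|v].
  have [dfx dfE] := Ck_diff Cf Ux.
  split; first by apply: differentiableV => //; exact: f0.
  rewrite diffV//; last exact: f0.
  by rewrite dfE; apply/funext => v /=; rewrite -exprVn expr2.
apply: CkM => //; last by exact: Ck_derive Cf.
by apply: CkN => //; apply: CkM => //; apply: IH => //; exact: CkW.
Qed.

(** No induction is required: the derivative of the logarithm is an inverse, already covered by
    [CkV]. *)
Lemma Ck_ln V k (U : set V) (f : V -> R) : open U -> (forall x, U x -> 0 < f x) ->
  Ck k U f -> Ck k U (fun x => ln (f x)).
Proof.
move=> oU f0; case: k => [|k] Cf.
  move=> x Ux; apply: continuous_comp; first exact: Cf.
  by apply: continuous_ln; exact: f0.
apply: (@Ck_is_diff _ _ _ _ _ (fun x v => (f x)^-1 * 'D_v f x)) => // [x Ux|v].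
  exact: (is_diff_real_comp (is_derive1_ln (f0 _ Ux)) (Ck_diff Cf Ux)).
apply: CkM => //; last by exact: Ck_derive Cf.
by apply: CkV => //; [move=> x /f0/lt0r_neq0|exact: CkW].
Qed.

End Ck.

(** * Closure properties of smooth and holomorphic maps *)

Section SmoothHolomorphic.
Context {R : realType}.

Lemma smooth_near m n (U : set 'rV[R]_m) (f g : 'rV[R]_m -> 'rV[R]_n) :
  open U -> (forall x, U x -> f x = g x) -> smooth U f -> smooth U g.
Proof. by move=> oU fg Cf k; apply/class_CE/(Ck_near oU fg)/class_CE/Cf. Qed.

Lemma smooth_comp l m n (U : set 'rV[R]_l) (U' : set 'rV[R]_m)
    (f : 'rV[R]_l -> 'rV[R]_m) (g : 'rV[R]_m -> 'rV[R]_n) :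
  open U -> open U' -> (forall x, U x -> U' (f x)) ->
  smooth U f -> smooth U' g -> smooth U (g \o f).
Proof.
move=> oU oU' UU' Cf Cg k; apply/class_CE.
by apply: (Ck_comp oU oU' UU'); apply/class_CE; [exact: Cf|exact: Cg].
Qed.

Lemma smooth_continuous m n (U : set 'rV[R]_m) (f : 'rV[R]_m -> 'rV[R]_n) :
  smooth U f -> forall x, U x -> {for x, continuous f}.
Proof. by move=> /(_ 0%N). Qed.

Lemma smooth_differentiable m n (U : set 'rV[R]_m) (f : 'rV[R]_m -> 'rV[R]_n) x :
  smooth U f -> U x -> differentiable f x.
Proof. by move=> /(_ 1%N)[df _]; exact: df. Qed.

Lemma smooth_linear m n (U : set 'rV[R]_m) (f : {linear 'rV[R]_m -> 'rV[R]_n}) :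
  open U -> continuous f -> smooth U f.
Proof. by move=> oU fc k; apply/class_CE/Ck_linear. Qed.

Lemma smooth_rV m n (U : set 'rV[R]_m) (f : 'rV[R]_m -> 'rV[R]_n) : open U ->
  (forall k j, Ck k U (fun x => f x 0 j)) -> smooth U f.
Proof. by move=> oU Cf k; apply/class_CE/Ck_rV. Qed.

Lemma holomorphic_near m n Jm Jn (U : set 'rV[R]_m) (f g : 'rV[R]_m -> 'rV[R]_n) :
  open U -> (forall x, U x -> f x = g x) ->
  holomorphic Jm Jn U f -> holomorphic Jm Jn U g.
Proof.
move=> oU fg [Cf Jf]; split; first exact: smooth_near Cf.
move=> x v Ux; have gf : \near x, g x = f x.
  have : nbhs x U by apply: open_nbhs_nbhs.
  by apply: filterS => y /fg.
by rewrite !(near_eq_derive _ gf) Jf.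
Qed.

Lemma holomorphic_comp l m n Jl Jm Jn (U : set 'rV[R]_l) (U' : set 'rV[R]_m)
    (f : 'rV[R]_l -> 'rV[R]_m) (g : 'rV[R]_m -> 'rV[R]_n) :
  open U -> open U' -> (forall x, U x -> U' (f x)) ->
  holomorphic Jl Jm U f -> holomorphic Jm Jn U' g -> holomorphic Jl Jn U (g \o f).
Proof.
move=> oU oU' UU' [Cf Jf] [Cg Jg]; split; first exact: smooth_comp Cg.
move=> x v Ux; have df := smooth_differentiable Cf Ux.
have dg := smooth_differentiable Cg (UU' _ Ux).
have dgf := differentiable_comp df dg.
rewrite !deriveE// diff_comp//= -!deriveE// Jf// Jg//; exact: UU'.
Qed.

Lemma holomorphic_linear m n (Jm : 'rV[R]_m -> 'rV[R]_m) (Jn : 'rV[R]_n -> 'rV[R]_n)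
    (U : set 'rV[R]_m) (f : {linear 'rV[R]_m -> 'rV[R]_n}) :
  open U -> continuous f -> {morph f : v / Jm v >-> Jn v} ->
  holomorphic Jm Jn U f.
Proof.
move=> oU fc fJ; split; first exact: smooth_linear.
by move=> x v _; rewrite !(is_diff_derive _ (is_diff_linear _ fc)) fJ.
Qed.

End SmoothHolomorphic.

(** * Slice charts *)

Section SliceCharts.
Context {R : realType} {d k : nat}.
Implicit Types (S W : set 'rV[R]_(d + k)) (Phi Psi : 'rV[R]_(d + k) -> 'rV[R]_(d + k)).
Implicit Types c : chart R 'rV[R]_(d + k) d.

(** Named so that its linearity can be registered, which lets [smooth_linear] and
    [holomorphic_linear] apply to it. *)
Definition slice_embed (y : 'rV[R]_d) : 'rV[R]_(d + k) := row_mx y 0.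

Lemma slice_embed_is_linear : linear slice_embed.
Proof. by move=> a x y; rewrite /slice_embed scale_row_mx add_row_mx scaler0 addr0. Qed.

HB.instance Definition _ := GRing.isLinear.Build R 'rV[R]_d 'rV[R]_(d + k) _ slice_embed
  slice_embed_is_linear.

Lemma continuous_slice_embed : continuous slice_embed.
Proof.
suff C0 : Ck 0 setT slice_embed by move=> x; exact: C0.
apply: Ck_rV => [|j]; first exact: openT.
rewrite /slice_embed; case: (split_ordP j) => i ->.
  apply: (@Ck_near _ _ _ _ _ (fun x : 'rV_d => x 0 i)) => [|x _|x _].
  - exact: openT.
  - by rewrite row_mxEl.
  - exact: coord_continuous.
apply: (@Ck_near _ _ _ _ _ (fun=> 0)) => [|x _|].
- exact: openT.
- by rewrite row_mxEr mxE.
- by apply: Ck_cst; exact: openT.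
Qed.

Lemma slice_chart_cim S W Phi Psi c : slice_chart S W Phi Psi c ->
  cim c = slice_embed @^-1` (Phi @` W).
Proof.
move=> [_ _ SW cd [cm _]]; apply/seteqP; split=> y /=.
  move=> [p cp <-]; have : (Phi @` (S `&` W)) (Phi p).
    by exists p => //; rewrite -cd.
  rewrite SW => -[PhiWp /= p0]; rewrite cm//.
  by rewrite /slice_embed -p0 hsubmxK.
move=> Wy; have : (Phi @` W `&` [set y | rsubmx y = 0]) (slice_embed y).
  by split=> //=; rewrite row_mxKr.
rewrite -SW => -[p]; rewrite -cd => cp Phip.
by exists p => //; rewrite cm// Phip row_mxKl.
Qed.

Lemma slice_chart_cinv S W Phi Psi c y : slice_chart S W Phi Psi c -> cim c y ->
  [/\ cdom c (cinv c y), cinv c y = Psi (slice_embed y) & Phi (cinv c y) = slice_embed y].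
Proof.
move=> sc cy; have cimE := slice_chart_cim sc.
case: sc => _ PsiK SW cd [_ ci].
have : (Phi @` W `&` [set y | rsubmx y = 0]) (slice_embed y).
  by split; [move: cy; rewrite cimE|rewrite /= row_mxKr].
rewrite -SW ci//= -/(slice_embed y) => -[p] [Sp Wp] <-.
by rewrite PsiK// cd.
Qed.

(** The chart and its inverse agree on their domains with [lsubmx \o Phi] and [Psi \o slice_embed],
    which are continuous there. *)
Lemma slice_chart_is_chart S W Phi Psi c : smooth W Phi -> smooth (Phi @` W) Psi ->
  slice_chart S W Phi Psi c -> is_chart S c.
Proof.
move=> CPhi CPsi sc; have cimE := slice_chart_cim sc.
case: (sc) => [[oW oPhiW] PsiK SW cd [cm ci]].
split.
- by exists W.
- by rewrite cimE; apply: open_comp => // x _; exact: continuous_slice_embed.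
- move=> p cp; have cip : cim c (cmap c p) by exists p.
  have [cdp ciE Phici] := slice_chart_cinv sc cip.
  have WS q : cdom c q -> W q by rewrite cd => -[].
  rewrite -[RHS]PsiK; last exact: WS.
  rewrite ciE; congr (Psi _).
  (* As [p] lies on [S], the second block of [Phi p] vanishes, so [Phi p] is recovered from its
     first block. *)
  have : (Phi @` (S `&` W)) (Phi p) by exists p => //; rewrite -cd.
  by rewrite SW cm// => -[_ /= p0]; rewrite /slice_embed -p0 hsubmxK.
- apply: (@subspace_eq_continuous _ _ _ (lsubmx \o Phi)).
    by move=> x; rewrite inE => cx; rewrite /from_subspace /= cm.
  apply: continuous_in_subspaceT => x; rewrite inE cd => -[_ Wx].
  apply: continuous_comp; first exact: (smooth_continuous CPhi).
  exact: continuous_lsubmx.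
- apply: (@subspace_eq_continuous _ _ _ (Psi \o slice_embed)).
    by move=> x; rewrite inE => cx; rewrite /from_subspace /= ci.
  apply: continuous_in_subspaceT => x; rewrite inE cimE => Wx.
  apply: continuous_comp; first exact: continuous_slice_embed.
  exact: (smooth_continuous CPsi).
Qed.

(** Gathers what is needed to replace a transition map by a composite of maps between open sets,
    independently of the regularity class; it serves the smooth and the holomorphic atlas alike. *)
Lemma slice_chart_transition S W Phi Psi c W' Phi' Psi' c' :
  smooth (Phi @` W) Psi -> slice_chart S W Phi Psi c ->
  slice_chart S W' Phi' Psi' c' ->
  let X := cmap c @` (cdom c `&` cdom c') in
  [/\ open X,
      forall y, X y -> (Phi @` W) (slice_embed y),
      forall y, X y -> W' (Psi (slice_embed y)) &
      forall y, X y -> (lsubmx \o Phi' \o Psi \o slice_embed) y = (cmap c' \o cinv c) y].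
Proof.
move=> CPsi sc sc' X; have cimE := slice_chart_cim sc.
(* In this form [X] is visibly open: it is the part of the open set [cim c] that a continuous map
   sends into [W']. *)
have XE : X = cim c `&` (Psi \o slice_embed) @^-1` W'.
  case: (sc') => _ _ _ cd' _; case: (sc) => _ PsiK _ cd [cm _].
  apply/seteqP; split=> y.
    move=> [p [cp c'p] <-]; have cip : cim c (cmap c p) by exists p.
    split=> //=; have [cdp ciE Phici] := slice_chart_cinv sc cip.
    suff <- : p = Psi (slice_embed (cmap c p)) by move: c'p; rewrite cd' => -[].
    have [_ _ SW _ _] := sc.
    have : (Phi @` (S `&` W)) (Phi p) by exists p => //; rewrite -cd.
    rewrite SW cm// => -[_ /= p0]; rewrite /slice_embed -p0 hsubmxK PsiK//.
    by move: cp; rewrite cd => -[].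
  move=> [cy W'y]; have [cdp ciE Phici] := slice_chart_cinv sc cy.
  exists (cinv c y).
    by split=> //; rewrite cd'; split; [move: cdp; rewrite cd => -[]|rewrite ciE].
  by rewrite cm// Phici row_mxKl.
split.
- rewrite XE; have oc : open (cim c).
    case: (sc) => [[_ oPhiW] _ _ _ _].
    by rewrite cimE; apply: open_comp => // x _; exact: continuous_slice_embed.
  case: (sc') => [[oW' _] _ _ _ _].
  rewrite openE => y [cy W'y]; apply: filterI; first exact: open_nbhs_nbhs.
  have : nbhs ((Psi \o slice_embed) y) W' by exact: open_nbhs_nbhs.
  apply: continuous_comp; first exact: continuous_slice_embed.
  by apply: (smooth_continuous CPsi); rewrite cimE in cy.
- by move=> y; rewrite XE cimE => -[].
- by move=> y; rewrite XE => -[].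
- move=> y; rewrite XE => -[cy W'y] /=.
  have [cdp ciE _] := slice_chart_cinv sc cy.
  have W'c : W' (cinv c y) by rewrite ciE.
  rewrite -ciE.
  case: (sc') => _ _ _ cd' [cm' _]; rewrite cm'// cd'; split=> //.
  by case: sc cdp => _ _ _ -> _ [].
Qed.

Lemma smooth_atlas_induced S :
  (forall p, S p -> exists2 c, induced_smooth_atlas S c & cdom c p) ->
  smooth_atlas S (induced_smooth_atlas S).
Proof.
move=> cov; split=> // [c [W [Phi [Psi [CPhi CPsi sc]]]]|].
  exact: slice_chart_is_chart sc.
move=> c c' [W [Phi [Psi [CPhi CPsi sc]]]] [W' [Phi' [Psi' [CPhi' CPsi' sc']]]].
have [oX XW XW' XE] := slice_chart_transition CPsi sc sc'.
apply: smooth_near XE _ => //.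
case: (sc) => [[oW oPhiW] _ _ _ _]; case: (sc') => [[oW' _] _ _ _ _].
have C0 := smooth_linear oX continuous_slice_embed.
have C1 := smooth_comp oX oPhiW XW C0 CPsi.
have C2 := smooth_comp oX oW' XW' C1 CPhi'.
apply: smooth_comp oX openT _ C2 _ => //.
exact/smooth_linear/continuous_lsubmx/openT.
Qed.

End SliceCharts.

(** * Diffeomorphisms between manifolds with global charts *)

Section GlobalCharts.
Context {R : realType}.

Section Diffeomorphism.
Context {d : nat} {S T : topologicalType} (M : set S) (N : set T).
Context (c : chart R S d) (c' : chart R T d).
Hypotheses (Mc : is_chart M c) (Nc' : is_chart N c').
Hypotheses (cM : cdom c = M) (c'N : cdom c' = N) (cc' : cim c = cim c').

Lemma cinv_mem p : M p -> N (cinv c' (cmap c p)).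
Proof.
rewrite -cM => cp; have : cim c (cmap c p) by exists p.
rewrite cc' => -[q c'q <-]; case: Nc' => _ _ c'K _ _.
by rewrite c'K// -c'N.
Qed.

Lemma cmapK p : M p -> cmap c' (cinv c' (cmap c p)) = cmap c p.
Proof.
rewrite -cM => cp; have : cim c (cmap c p) by exists p.
by rewrite cc' => -[q c'q <-]; case: Nc' => _ _ c'K _ _; rewrite c'K.
Qed.

Lemma smooth_map_global_charts A B : A c -> B c' ->
  smooth_map M A N B (cinv c' \o cmap c).
Proof.
move=> Ac Bc'; split; first exact: cinv_mem.
move=> p Mp; exists c, c'; split=> //; first by rewrite cM.
  by rewrite cM c'N => _ [q Mq <-]; exact: cinv_mem.
case: Mc => _ oc cK _ _.
(* Read in the two charts, the map is the identity of [cim c]. *)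
apply: (@smooth_near _ _ _ _ id) => // [y [q cq <-] /=|].
  by rewrite cK// cmapK// -cM.
move=> k; apply/class_CE; apply: (@Ck_linear _ _ _ _ _ idfun) => //.
by move=> x; exact: cvg_id.
Qed.

End Diffeomorphism.

Lemma diffeomorphism_global_charts d (S T : topologicalType) (M : set S)
    (N : set T) (c : chart R S d) (c' : chart R T d) A B :
  is_chart M c -> is_chart N c' -> cdom c = M -> cdom c' = N ->
  cim c = cim c' -> A c -> B c' ->
  diffeomorphism M A N B (cinv c' \o cmap c).
Proof.
move=> Mc Nc' cM c'N cc' Ac Bc'; split; first exact: smooth_map_global_charts.
(* The inverse is the same construction with the two charts exchanged. *)
exists (cinv c \o cmap c'); split.
- exact: smooth_map_global_charts.
- move=> p Mp /=; rewrite (cmapK Nc' cM cc' Mp).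
  by case: Mc => _ _ cK _ _; rewrite cK// cM.
- move=> q Nq /=; rewrite (cmapK Mc c'N (esym cc') Nq).
  by case: Nc' => _ _ cK _ _; rewrite cK// c'N.
Qed.

Definition straight_chart d k (S : set 'rV[R]_(d + k))
    (Phi Psi : 'rV[R]_(d + k) -> 'rV[R]_(d + k)) : chart R 'rV[R]_(d + k) d :=
  Chart S (lsubmx \o Phi) (Psi \o slice_embed).

(** Since [Psi] is a right inverse of [Phi] on the whole space, [Phi] maps [W] onto everything and
    the chart has image all of R^d. Two surfaces straightened in this way therefore have charts with
    the same image. *)
Lemma slice_straight_chart d k (S W : set 'rV[R]_(d + k))
    (Phi Psi : 'rV[R]_(d + k) -> 'rV[R]_(d + k)) :
  open W -> (forall x, W x -> Psi (Phi x) = x) ->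
  (forall y, W (Psi y) /\ Phi (Psi y) = y) ->
  (forall x, S x <-> W x /\ rsubmx (Phi x) = 0) ->
  [/\ Phi @` W = setT, slice_chart S W Phi Psi (straight_chart S Phi Psi) &
      cim (straight_chart S Phi Psi) = setT].
Proof.
move=> oW PhiK PsiK SW.
have PhiW : Phi @` W = setT.
  apply/seteqP; split=> y // _; have [WPsi Phiy] := PsiK y.
  by exists (Psi y).
have sc : slice_chart S W Phi Psi (straight_chart S Phi Psi).
  split=> //.
  - by split=> //; rewrite PhiW; exact: openT.
  - apply/seteqP; split=> y.
      by move=> [x [/SW [Wx Phix0] _] <-]; split=> //; exists x.
    by move=> [[x Wx <-] Phix0]; exists x => //; split=> //; apply/SW.
  - by apply/esym/setIidl => x /SW[].
by split=> //; rewrite (slice_chart_cim sc) PhiW.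
Qed.

End GlobalCharts.

(** * Compatibility with the complex structures and the holomorphic atlas *)

Section HolomorphicAtlas.
Context {R : realType}.
Implicit Types S : set 'rV[R]_(2 + 2).

Lemma R4toC2_slice_embed (y : 'rV[R]_2) :
  R4toC2 (@slice_embed R 2 2 y) = (R2toC y, 0).
Proof.
rewrite /R4toC2 /R2toC /slice_embed.
(* The four indices are rewritten as shifts of indices of the two blocks, so that the rules for
   [row_mx] apply. *)
have -> : Ordinal (isT : 0 < 4)%N = lshift 2 (Ordinal (isT : 0 < 2)%N) by exact: val_inj.
have -> : Ordinal (isT : 1 < 4)%N = lshift 2 (Ordinal (isT : 1 < 2)%N) by exact: val_inj.
have -> : Ordinal (isT : 2 < 4)%N = rshift 2 (Ordinal (isT : 0 < 2)%N) by exact: val_inj.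
have -> : Ordinal (isT : 3 < 4)%N = rshift 2 (Ordinal (isT : 1 < 2)%N) by exact: val_inj.
by rewrite !row_mxEl !row_mxEr !mxE.
Qed.

(** Makes [holomorphic_linear] applicable to the inclusion of C in C^2; [lsubmx_J4] does the same
    for the projection. *)
Lemma slice_embed_J2 : {morph (@slice_embed R 2 2) : y / J2 y >-> J4 y}.
Proof.
move=> y; rewrite /J4 R4toC2_slice_embed mulr0 /J2 /slice_embed /=.
apply/rowP => j; case: (split_ordP j) => i ->; rewrite ?row_mxEl ?row_mxEr !mxE /=.
  by case: i => [[|[|[]]]] //= ?.
by case: i => [[|[|[]]]] //= ?.
Qed.

Lemma lsubmx_J4 : {morph (@lsubmx R 1 2 2) : x / J4 x >-> J2 x}.
Proof.
move=> x; apply/rowP => j; rewrite !mxE /= /R2toC !mxE.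
have -> : lshift 2 (Ordinal (isT : 0 < 2)%N) = Ordinal (isT : 0 < 4)%N by exact: val_inj.
have -> : lshift 2 (Ordinal (isT : 1 < 2)%N) = Ordinal (isT : 1 < 4)%N by exact: val_inj.
by case: j => [[|[|[]]]] //= ?.
Qed.

Lemma induced_holomorphic_smooth S :
  induced_holomorphic_atlas S `<=` induced_smooth_atlas S.
Proof. by move=> c [W [Phi [Psi [[CPhi _] [CPsi _] sc]]]]; exists W, Phi, Psi. Qed.

Lemma holomorphic_atlas_induced S :
  (forall p, S p -> exists2 c, induced_holomorphic_atlas S c & cdom c p) ->
  holomorphic_atlas S (induced_holomorphic_atlas S).
Proof.
move=> cov; split=> // [c [W [Phi [Psi [[CPhi _] [CPsi _] sc]]]]|].
  exact: slice_chart_is_chart sc.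
move=> c c' [W [Phi [Psi [HPhi HPsi sc]]]] [W' [Phi' [Psi' [HPhi' HPsi' sc']]]].
have [CPsi _] := HPsi.
have [oX XW XW' XE] := slice_chart_transition CPsi sc sc'.
apply: holomorphic_near XE _ => //.
case: (sc) => [[oW oPhiW] _ _ _ _]; case: (sc') => [[oW' _] _ _ _ _].
have H0 := holomorphic_linear oX continuous_slice_embed slice_embed_J2.
have H1 := holomorphic_comp oX oPhiW XW H0 HPsi.
have H2 := holomorphic_comp oX oW' XW' H1 HPhi'.
apply: holomorphic_comp oX openT _ H2 _ => //.
apply: holomorphic_linear lsubmx_J4; first exact: openT.
exact: continuous_lsubmx.
Qed.

End HolomorphicAtlas.

(** * The Riemann surface of the logarithm *)

Section SigmaLog.
Context {R : realType}.

Lemma rV4P (x y : 'rV[R]_(2 + 2)) :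
  [/\ x 0 (@Ordinal 4 0 isT) = y 0 (@Ordinal 4 0 isT),
      x 0 (@Ordinal 4 1 isT) = y 0 (@Ordinal 4 1 isT),
      x 0 (@Ordinal 4 2 isT) = y 0 (@Ordinal 4 2 isT) &
      x 0 (@Ordinal 4 3 isT) = y 0 (@Ordinal 4 3 isT)] -> x = y.
Proof.
move=> [x0 x1 x2 x3]; apply/rowP => -[[|[|[|[|//]]]] jlt].
- by rewrite (_ : Ordinal jlt = @Ordinal 4 0 isT)//; exact: val_inj.
- by rewrite (_ : Ordinal jlt = @Ordinal 4 1 isT)//; exact: val_inj.
- by rewrite (_ : Ordinal jlt = @Ordinal 4 2 isT)//; exact: val_inj.
- by rewrite (_ : Ordinal jlt = @Ordinal 4 3 isT)//; exact: val_inj.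
Qed.

(** The parameter puts the straightening ([s = - 1]) and its inverse ([s = 1]) in one family, so
    that regularity is proved once for both. *)
Definition exp_shear (s : R) (x : 'rV[R]_(2 + 2)) : 'rV[R]_(2 + 2) :=
  let p := R4toC2 x in
  C2toR4 (p.1, p.2 + s%:C%C * expC p.1).

(** The differential of the shear at [x], in complex form, using that exp is its own derivative. *)
Definition exp_shear_diff (s : R) (x v : 'rV[R]_(2 + 2)) : 'rV[R]_(2 + 2) :=
  let p := R4toC2 x in let q := R4toC2 v in
  C2toR4 (q.1, q.2 + s%:C%C * (expC p.1 * q.1)).

Lemma exp_shearK s x : exp_shear (- s) (exp_shear s x) = x.
Proof.
apply: rV4P; rewrite !mxE /= /expC !mxE /=.
by split=> //; ring.
Qed.

(** These are the Cauchy-Riemann equations of the shear. In each real coordinate they are a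
    polynomial identity in e^u, cos v, sin v and the entries of [v]. *)
Lemma J4_exp_shear_diff s x v :
  exp_shear_diff s x (J4 v) = J4 (exp_shear_diff s x v).
Proof.
apply: rV4P; rewrite !mxE /= /expC !mxE /=.
by split=> //; ring.
Qed.

Lemma is_diff_exp_shear s x : is_diff x (exp_shear s) (exp_shear_diff s x).
Proof.
have dc j := @is_diff_coord R _ _ _ _ _ _ 0 j (is_diff_id x).
have d0 := dc (@Ordinal 4 0 isT); have d1 := dc (@Ordinal 4 1 isT).
have dexp := is_diff_real_comp (is_derive_expR _) d0.
have dcos := is_diff_real_comp (is_derive_cos _) d1.
have dsin := is_diff_real_comp (is_derive_sin _) d1.
(* Real and imaginary parts of w + s e^z, differentiated as real functions of the four
   coordinates. *)
have dre := is_diffD (dc (@Ordinal 4 2 isT)) (is_diffZ s (is_diffM dexp dcos)).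
have dim := is_diffD (dc (@Ordinal 4 3 isT)) (is_diffZ s (is_diffM dexp dsin)).
apply: is_diff_rV => -[[|[|[|[|//]]]] jlt].
- apply: (near_eq_is_diff _ (is_diff_eq d0 _)).
    by apply: filterE => y; rewrite mxE.
  by apply/funext => v; rewrite mxE.
- apply: (near_eq_is_diff _ (is_diff_eq d1 _)).
    by apply: filterE => y; rewrite mxE.
  by apply/funext => v; rewrite mxE.
- apply: (near_eq_is_diff _ (is_diff_eq dre _)).
    by apply: filterE => y; rewrite mxE /= !fctE /= /GRing.scale /=; ring.
  by apply/funext => v; rewrite mxE /= !fctE /= /GRing.scale /=; ring.
- apply: (near_eq_is_diff _ (is_diff_eq dim _)).
    by apply: filterE => y; rewrite mxE /= !fctE /= /GRing.scale /=; ring.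
  by apply/funext => v; rewrite mxE /= !fctE /= /GRing.scale /=; ring.
Qed.

Lemma Ck_coordinate k m (U : set 'rV[R]_m) (j : 'I_m) : open U ->
  Ck k U (fun x : 'rV[R]_m => x 0 j).
Proof.
move=> oU; apply: (@Ck_coord _ _ _ _ _ id) => //.
by apply: (@Ck_linear _ _ _ _ _ idfun) => // x; exact: cvg_id.
Qed.

Lemma smooth_exp_shear s : smooth setT (exp_shear s).
Proof.
have oT : open [set: 'rV[R]_(2 + 2)] by exact: openT.
apply: smooth_rV => // k j.
have C i := @Ck_coordinate k _ _ i oT.
have Ce := Ck_expR oT (C (@Ordinal 4 0 isT)).
have [Cc Cs] := Ck_cos_sin oT (C (@Ordinal 4 1 isT)).
have Cre := CkD oT (C (@Ordinal 4 2 isT)) (CkM oT (Ck_cst k s oT) (CkM oT Ce Cc)).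
have Cim := CkD oT (C (@Ordinal 4 3 isT)) (CkM oT (Ck_cst k s oT) (CkM oT Ce Cs)).
case: j => -[|[|[|[|//]]]] jlt.
- by apply: Ck_near (C (@Ordinal 4 0 isT)) => // x _; rewrite mxE.
- by apply: Ck_near (C (@Ordinal 4 1 isT)) => // x _; rewrite mxE.
- by apply: Ck_near Cre => // x _; rewrite mxE /=; ring.
- by apply: Ck_near Cim => // x _; rewrite mxE /=; ring.
Qed.

Lemma holomorphic_exp_shear s : holomorphic (@J4 R) (@J4 R) setT (exp_shear s).
Proof.
split; first exact: smooth_exp_shear.
move=> x v _; rewrite !(is_diff_derive _ (is_diff_exp_shear s x)).
exact: J4_exp_shear_diff.
Qed.

(** The second block of the shear at (z, w) is w - e^z, which vanishes exactly on the graph. *)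
Lemma Sigma_logP x : Sigma_log R x <-> rsubmx (exp_shear (- 1) x) = 0.
Proof.
split=> [[_ [z _ <-] <-]|x0].
  apply/rowP => -[[|[|//]] jlt]; rewrite !mxE /= /expC !mxE /=;
  by case: z => u v /=; ring.
exists ((R4toC2 x).1, expC (R4toC2 x).1); first by exists (R4toC2 x).1.
have := congr1 (fun y : 'rV[R]_2 => y 0 (@Ordinal 2 0 isT)) x0.
have := congr1 (fun y : 'rV[R]_2 => y 0 (@Ordinal 2 1 isT)) x0.
rewrite !mxE /= => x3 x2.
apply: rV4P; rewrite !mxE /=; split=> //; apply/eqP; rewrite eq_sym -subr_eq0.
  by rewrite -x2; apply/eqP; ring.
by rewrite -x3; apply/eqP; ring.
Qed.

Definition log_chart : chart R 'rV[R]_(2 + 2) 2 :=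
  straight_chart (Sigma_log R) (exp_shear (- 1)) (exp_shear 1).

(** One chart serves twice: it covers the surface for the holomorphic atlas and, by
    [induced_holomorphic_smooth], for the smooth one. *)
Lemma log_chartP : induced_holomorphic_atlas (Sigma_log R) log_chart /\
  cim log_chart = setT.
Proof.
have [||||ET sc cT] := @slice_straight_chart R 2 2 (Sigma_log R) setT
    (exp_shear (- 1)) (exp_shear 1).
- exact: openT.
(* Here [1] is written [- - 1] to match [exp_shearK]. *)
- by move=> x _; rewrite -[X in exp_shear X]opprK exp_shearK.
- by move=> y; rewrite exp_shearK.
- by move=> x; rewrite Sigma_logP; split=> // -[].
split=> //; exists setT, (exp_shear (- 1)), (exp_shear 1).
by rewrite ET; split=> //; exact: holomorphic_exp_shear.
Qed.

End SigmaLog.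

(** * The helicoid *)

Section Helicoid.
Context {R : realType} (a : R).
Hypothesis a0 : 0 < a.

Lemma rV3P (x y : 'rV[R]_(2 + 1)) :
  [/\ x 0 (@Ordinal 3 0 isT) = y 0 (@Ordinal 3 0 isT),
      x 0 (@Ordinal 3 1 isT) = y 0 (@Ordinal 3 1 isT) &
      x 0 (@Ordinal 3 2 isT) = y 0 (@Ordinal 3 2 isT)] -> x = y.
Proof.
move=> [x0 x1 x2]; apply/rowP => -[[|[|[|//]]] jlt].
- by rewrite (_ : Ordinal jlt = @Ordinal 3 0 isT)//; exact: val_inj.
- by rewrite (_ : Ordinal jlt = @Ordinal 3 1 isT)//; exact: val_inj.
- by rewrite (_ : Ordinal jlt = @Ordinal 3 2 isT)//; exact: val_inj.
Qed.

(* With v = x_2 / a, the pair (along x, across x) is (x_0, x_1) read in the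
   frame (cos v, sin v), (- sin v, cos v) rotating with the height x_2. *)
Definition along (x : 'rV[R]_(2 + 1)) : R :=
  let v := x 0 (@Ordinal 3 2 isT) / a in
  x 0 (@Ordinal 3 0 isT) * cos v + x 0 (@Ordinal 3 1 isT) * sin v.

Definition across (x : 'rV[R]_(2 + 1)) : R :=
  let v := x 0 (@Ordinal 3 2 isT) / a in
  x 0 (@Ordinal 3 1 isT) * cos v - x 0 (@Ordinal 3 0 isT) * sin v.

(** Meant for points with [0 < along x], where the logarithm is genuine; at the point of the
    helicoid with parameters u, v it returns (u, v, 0). *)
Definition untwist (x : 'rV[R]_(2 + 1)) : 'rV[R]_(2 + 1) :=
  \row_(j < 2 + 1)
    [:: ln (along x); x 0 (@Ordinal 3 2 isT) / a; across x]`_j.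

(** At [t = 0] this is the parametrisation of the helicoid; [t] displaces the point horizontally
    along (- sin v, cos v), orthogonally to the ruling. *)
Definition twist (y : 'rV[R]_(2 + 1)) : 'rV[R]_(2 + 1) :=
  let r := expR (y 0 (@Ordinal 3 0 isT)) in
  let v := y 0 (@Ordinal 3 1 isT) in
  let t := y 0 (@Ordinal 3 2 isT) in
  \row_(j < 2 + 1)
    [:: r * cos v - t * sin v; r * sin v + t * cos v; a * v]`_j.

Let aK v : a * v / a = v. Proof. by rewrite mulrC mulKf// gt_eqF. Qed.

Lemma along_twist y : along (twist y) = expR (y 0 (@Ordinal 3 0 isT)).
Proof.
rewrite /along !mxE /= aK.
(* Multiplying the right-hand side by cos^2 + sin^2 turns the claim into a polynomial identity. *)
by rewrite -[RHS]mulr1 -(cos2Dsin2 (y 0 (@Ordinal 3 1 isT))); ring.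
Qed.

Lemma across_twist y : across (twist y) = y 0 (@Ordinal 3 2 isT).
Proof.
rewrite /across !mxE /= aK.
by rewrite -[RHS]mulr1 -(cos2Dsin2 (y 0 (@Ordinal 3 1 isT))); ring.
Qed.

Lemma twistK y : untwist (twist y) = y.
Proof.
by apply: rV3P; rewrite !mxE along_twist across_twist expRK /= aK.
Qed.

Lemma untwistK x : 0 < along x -> twist (untwist x) = x.
Proof.
move=> x0; apply: rV3P; rewrite !mxE /= lnK ?posrE// /along /across.
set v := _ / a; split.
- by rewrite -[RHS]mulr1 -(cos2Dsin2 v); ring.
- by rewrite -[RHS]mulr1 -(cos2Dsin2 v); ring.
- by rewrite /v mulrC divfK// gt_eqF.
Qed.

(** Vanishing of [across] alone describes the full ruled surface, with the axis and the opposite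
    half-lines; [0 < along x] selects the half-lines on which the factor is some e^u. *)
Lemma helicoidP x : helicoid a x <-> 0 < along x /\ rsubmx (untwist x) = 0.
Proof.
split=> [[_ [z _ <-] <-]|[x0 h0]].
  case: z => u v; rewrite (_ : CRtoR3 _ =
      twist (\row_(j < 2 + 1) [:: u; v; 0]`_j)); last first.
    by apply: rV3P; rewrite !mxE /=; split=> //; ring.
  rewrite along_twist expR_gt0 twistK; split=> //.
  by apply/rowP => -[[|//] jlt]; rewrite !mxE.
have h : across x = 0.
  by have := congr1 (fun y : 'rV[R]_1 => y 0 0) h0; rewrite !mxE.
set v := x 0 (@Ordinal 3 2 isT) / a.
(* The parameters are the first two coordinates of [untwist x]; the third is zero, so [twist] at
   these values is the point of the helicoid. *)
exists (Exp a (ln (along x) +i* v)%C); first by exists (ln (along x) +i* v)%C.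
rewrite -[RHS]untwistK//; apply: rV3P; rewrite !mxE /= h -/v.
by split=> //; ring.
Qed.

Lemma Ck_along k : Ck k setT along.
Proof.
have oT : open [set: 'rV[R]_(2 + 1)] by exact: openT.
have C i := @Ck_coordinate _ k _ _ i oT.
have [Cc Cs] := Ck_cos_sin oT (CkM oT (C (@Ordinal 3 2 isT)) (Ck_cst k a^-1 oT)).
exact: CkD oT (CkM oT (C (@Ordinal 3 0 isT)) Cc) (CkM oT (C (@Ordinal 3 1 isT)) Cs).
Qed.

Lemma open_along_gt0 : open [set x | 0 < along x].
Proof.
apply: (@open_comp _ _ along [set r | 0 < r]) => [x _|]; last exact: open_gt.
exact: (Ck_along 0).
Qed.

Lemma smooth_untwist : smooth [set x | 0 < along x] untwist.
Proof.
have oW := open_along_gt0; apply: smooth_rV => // k j.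
have C i := @Ck_coordinate _ k _ _ i oW.
have Cv := CkM oW (C (@Ordinal 3 2 isT)) (Ck_cst k a^-1 oW).
have [Cc Cs] := Ck_cos_sin oW Cv.
have Cl := Ck_ln oW (fun x h => h) (Ck_subset (@subsetT _ _) (Ck_along k)).
have Ch := CkB oW (CkM oW (C (@Ordinal 3 1 isT)) Cc) (CkM oW (C (@Ordinal 3 0 isT)) Cs).
case: j => -[|[|[|//]]] jlt.
- by apply: Ck_near Cl => // x _; rewrite mxE.
- by apply: Ck_near Cv => // x _; rewrite mxE.
- by apply: Ck_near Ch => // x _; rewrite mxE.
Qed.

Lemma smooth_twist : smooth setT twist.
Proof.
have oT : open [set: 'rV[R]_(2 + 1)] by exact: openT.
apply: smooth_rV => // k j.
have C i := @Ck_coordinate _ k _ _ i oT.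
have Ce := Ck_expR oT (C (@Ordinal 3 0 isT)).
have [Cc Cs] := Ck_cos_sin oT (C (@Ordinal 3 1 isT)).
have Ct := C (@Ordinal 3 2 isT).
have C0 := CkB oT (CkM oT Ce Cc) (CkM oT Ct Cs).
have C1 := CkD oT (CkM oT Ce Cs) (CkM oT Ct Cc).
have C2 := CkM oT (Ck_cst k a oT) (C (@Ordinal 3 1 isT)).
case: j => -[|[|[|//]]] jlt.
- by apply: Ck_near C0 => // x _; rewrite mxE.
- by apply: Ck_near C1 => // x _; rewrite mxE.
- by apply: Ck_near C2 => // x _; rewrite mxE.
Qed.

Definition helicoid_chart : chart R 'rV[R]_(2 + 1) 2 :=
  straight_chart (helicoid a) untwist twist.

Lemma helicoid_chartP : induced_smooth_atlas (helicoid a) helicoid_chart /\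
  cim helicoid_chart = setT.
Proof.
have [||||ET sc cT] := @slice_straight_chart R 2 1 (helicoid a)
    [set x | 0 < along x] untwist twist.
- exact: open_along_gt0.
- exact: untwistK.
- by move=> y; split; [rewrite /= along_twist expR_gt0|exact: twistK].
- exact: helicoidP.
split=> //; exists [set x | 0 < along x], untwist, twist.
by rewrite ET; split=> //; [exact: smooth_untwist|exact: smooth_twist].
Qed.

End Helicoid.

Theorem theorem2p8 (R : realType) (a : R) (ha : 0 < a) :
  [/\ smooth_atlas (helicoid a) (induced_smooth_atlas (helicoid a)),
      smooth_atlas (Sigma_log R) (induced_smooth_atlas (Sigma_log R)),
      holomorphic_atlas (Sigma_log R)
        (induced_holomorphic_atlas (Sigma_log R)),
      induced_holomorphic_atlas (Sigma_log R)
        `<=` induced_smooth_atlas (Sigma_log R) &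
      exists Xi : 'rV[R]_(2 + 1) -> 'rV[R]_(2 + 2),
        diffeomorphism
          (helicoid a) (induced_smooth_atlas (helicoid a))
          (Sigma_log R) (induced_smooth_atlas (Sigma_log R)) Xi].
Proof.
have [helA helT] := helicoid_chartP ha.
have [logH logT] := @log_chartP R.
have logA := induced_holomorphic_smooth logH.
have hel_atlas : smooth_atlas (helicoid a) (induced_smooth_atlas (helicoid a)).
  by apply: smooth_atlas_induced => p Sp; exists (helicoid_chart a).
have log_atlas : smooth_atlas (Sigma_log R) (induced_smooth_atlas (Sigma_log R)).
  by apply: smooth_atlas_induced => p Sp; exists log_chart.
split=> //.
- by apply: holomorphic_atlas_induced => p Sp; exists log_chart.
- exact: induced_holomorphic_smooth.
(* On the helicoid this map sends (e^u cos v, e^u sin v, a v) to (u, v, e^u cos v, e^u sin v). *)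
exists (cinv log_chart \o cmap (helicoid_chart a)).
case: hel_atlas => /(_ _ helA) cH _ _; case: log_atlas => /(_ _ logA) cL _ _.
by apply: diffeomorphism_global_charts => //; rewrite helT logT.
Qed.
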